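(* Let $q$ and $n$ be positive integers with $q\ge n$. Let the tropical holomorphic curve $f:\mathbb{R}\to\mathbb{TP}^n$ be tropical algebraically nondegenerate. Assume that $P_j$ $(j=1,\dots,q)$ are homogeneous tropical polynomials of degree $d_j$, and let $d$ be the least common multiple of $d_1,\dots,d_q$. Let $M=\binom{n+d}{d}-1$. If $\lambda=\mathrm{ddg}(\{P_{M+2}\circ f,\dots,P_q\circ f\})$ and $$\limsup_{r\to\infty}\frac{\log T_f(r)}{r}=0,$$ then $$\sum_{j=1}^{q}\delta_f(V_{P_j})\le M+1+\lambda\quad\text{and}\quad\sum_{j=M+2}^{q}\delta_f(V_{P_j})\le\lambda.$$ In the special case $\lambda=0$, $\delta_f(V_{P_j})=0$ for each $j\in\{M+2,\dots,q\}$.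
   Context: Tropical semiring: $\mathbb{R}_{\max}=\mathbb{R}\cup\{-\infty\}$ with $x\oplus y=\max(x,y)$, $x\odot y=x+y$, $x\oslash y=x-y$, $x^{\odot a}=ax$, $0_o=-\infty$, $1_o=0$. $\mathbb{TP}^n$ is $\mathbb{R}_{\max}^{n+1}\setminus\{(0_o,\dots,0_o)\}$ modulo $(a_0,\dots,a_n)\sim(\mu+a_0,\dots,\mu+a_n)$, $\mu\in\mathbb{R}$. A tropical meromorphic function is a continuous piecewise linear $f:\mathbb{R}\to\mathbb{R}$ (possibly infinitely many pieces, derivative discontinuities locally finite). With $\omega_f(x)=\lim_{\varepsilon\to0+}\{f'(x+\varepsilon)-f'(x-\varepsilon)\}$, $x$ is a zero of multiplicity $\omega_f(x)$ if $\omega_f(x)>0$ and a pole of multiplicity $-\omega_f(x)$ if $\omega_f(x)<0$. A tropical entire function is a tropical meromorphic function without poles (equivalently, convex). $n(r,f)$ is the number of poles of $f$ in $(-r,r)$ counted with multiplicity, and $N(r,f)=\frac12\int_0^r n(t,f)\,dt$. So $N(r,1_o\oslash h)$, where $1_o\oslash h=-h$, counts the zeros of $h$. A tropical holomorphic curve $f=[f_0:\dots:f_n]:\mathbb{R}\to\mathbb{TP}^n$ is given by a reduced representation $(f_0,\dots,f_n)$ of tropical entire functions with no zero common to all of them. With $\|f(x)\|=\max_j f_j(x)$, $T_f(r)=\frac12[\|f(r)\|+\|f(-r)\|]-\|f(0)\|$ (independent of the reduced representation). A homogeneous tropical polynomial of degree $d$ is $P(x)=\bigoplus_{i_0+\dots+i_n=d}c_{i_0,\dots,i_n}\odot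 x_0^{\odot i_0}\odot\cdots\odot x_n^{\odot i_n}$ with $c_{i_0,\dots,i_n}\in\mathbb{R}_{\max}$ not all $0_o$, $i_k\in\mathbb{N}_0$. The tropical hypersurface $V_P$ is the set of points at which the maximum defining $P$ is attained by at least two monomials. $P\circ f=P(f_0,\dots,f_n)$, and $P^{\odot s}=s\cdot P$ as a function. $f$ is tropical algebraically nondegenerate if $f(\mathbb{R})\not\subset V_P$ for every tropical hypersurface $V_P$ in $\mathbb{TP}^n$ (of any degree). Let $I_0,\dots,I_M$ enumerate the exponents $(i_0,\dots,i_n)\in\mathbb{N}_0^{n+1}$ with $i_0+\dots+i_n=d$, and $f^{I}=f_0^{\odot i_0}\odot\cdots\odot f_n^{\odot i_n}$ for $I=(i_0,\dots,i_n)$. For $F=\bigoplus_{k=0}^M a_k\odot f^{I_k}$, $a_k\in\mathbb{R}_{\max}$, not identically $0_o$, $\hat\ell(F)$ is the smallest $j\in\{1,\dots,M+1\}$ such that $F=\bigoplus_{i=1}^j b_{i}\odot f^{I_{k_i}}$ for some $0\le k_1<\dots<k_j\le M$ and real $b_i$. $F$ is complete if $\hat\ell(F)=M+1$. The degree of degeneracy $\mathrm{ddg}(Q)$ of a collection $Q$ of such $F$ is the number of non-complete elements of $Q$. Here the elements are indexed by $j=M+2,\dots,q$, and when $d_j<d$ the completeness of $P_j\circ f$ is that of $P_j^{\odot d/d_j}\circ f$, which is a combination of the $f^{I_k}$. Defect: for a homogeneous tropical polynomial $P$ of degree $d_P$ with coefficient vector $a$ and $\|a\|$ its maximal coordinate,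 $m_f(r,V_P)=\frac12\sum_{\sigma=\pm1}\lambda_{V_P}(f(\sigma r))$ with $\lambda_{V_P}(f(x))=d_P\|f(x)\|+d_P\|a\|-P(f)(x)$, and $$\delta_f(V_P)=\liminf_{r\to\infty}\frac{m_f(r,V_P)}{d_P\,T_f(r)}=1-\limsup_{r\to\infty}\frac{N(r,1_o\oslash(P\circ f))}{d_P\,T_f(r)}.$$ *)

(* Defs.v *)
From HB Require Import structures.
From mathcomp Require Import all_boot all_order all_algebra.
From mathcomp Require Import all_classical all_reals all_analysis.
Set Implicit Arguments.
Unset Strict Implicit.
Unset Printing Implicit Defensive.
Import Order.TTheory GRing.Theory Num.Theory.
Import numFieldNormedType.Exports.
Local Open Scope classical_set_scope.
Local Open Scope ring_scope.

(* The tropical semiring R_max is represented inside \bar R (with +oo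
   excluded): tropical sum is maxe, tropical product is addition, 0_o = -oo.
   The tropical power x^{(.) a}, a natural, is x *+ a, so -oo *+ 0 = 0 = 1_o. *)

Section TropicalFunctions.
Variable R : realType.
Implicit Types h : R -> R.

Definition piecewise_linear h : Prop :=
  exists S : set R,
    (forall a b : R, finite_set (S `&` `[a, b])) /\
    (forall x, ~ S x -> exists m c : R, \forall y \near x, h y = m * y + c).

Definition tropical_meromorphic h : Prop :=
  continuous h /\ piecewise_linear h.

Definition omega h (x : R) : R :=
  lim ((fun e : R => derive1 h (x + e) - derive1 h (x - e)) @ 0^'+).

Definition is_tropical_zero h (x : R) : Prop := 0 < omega h x.
Definition is_tropical_pole h (x : R) : Prop := omega h x < 0.

Definition tropical_entire h : Prop :=
  tropical_meromorphic h /\ forall x, ~ is_tropical_pole h x.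

End TropicalFunctions.

Section Curves.
Variables (R : realType) (n : nat).
Implicit Types f : 'I_n.+1 -> R -> R.

(* A curve R -> TP^n is handled through a reduced representation. *)
Definition reduced_representation f : Prop :=
  (forall i, tropical_entire (f i)) /\
  (forall x, ~ (forall i, is_tropical_zero (f i) x)).

Definition curve_point f (x : R) : 'I_n.+1 -> \bar R := fun i => (f i x)%:E.

Definition curve_norm f (x : R) : R := \big[Num.max/f ord0 x]_(i < n.+1) f i x.

Definition characteristic f (r : R) : R :=
  2^-1 * (curve_norm f r + curve_norm f (- r)) - curve_norm f 0.

End Curves.

Definition expo (n d : nat) : finType :=
  {t : n.+1.-tuple 'I_d.+1 | \sum_(i <- t) nat_of_ord i == d}%N.

Definition expo_at n d (I : expo n d) (i : 'I_n.+1) : nat := tnth (val I) i.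

Lemma card_expo n d : #|expo n d| = 'C(n + d, d).
Proof.
rewrite card_sig -(bin_sub (leq_addl n d)) addnK -card_ord_partitions.
by rewrite cardsE; apply: eq_card.
Qed.

Section Polynomials.
Variables (R : realType) (n : nat).
Local Open Scope ereal_scope.

Record hpoly (d : nat) := HPoly {
  coef :> expo n d -> \bar R;
  coef_lty : forall I, coef I < +oo;
  coef_nontrivial : exists I, -oo < coef I }.

Definition hpoly_term d (P : hpoly d) (x : 'I_n.+1 -> \bar R) (I : expo n d)
  : \bar R := P I + \sum_(i < n.+1) x i *+ expo_at I i.

Definition hpoly_eval d (P : hpoly d) (x : 'I_n.+1 -> \bar R) : \bar R :=
  \big[maxe/-oo]_(I : expo n d) hpoly_term P x I.

Definition coef_norm d (P : hpoly d) : \bar R := \big[maxe/-oo]_(I : expo n d) P I.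

(* Points of TP^n are given by homogeneous coordinates. *)
Definition tropical_hypersurface d (P : hpoly d) : set ('I_n.+1 -> \bar R) :=
  [set x | (forall i, x i < +oo) /\ (exists i, -oo < x i) /\
    exists I J : expo n d, [/\ I != J, hpoly_term P x I = hpoly_eval P x
                                     & hpoly_term P x J = hpoly_eval P x]].

Variable f : 'I_n.+1 -> R -> R.

Definition hpoly_comp d (P : hpoly d) (x : R) : \bar R :=
  hpoly_eval P (curve_point f x).

Definition algebraically_nondegenerate : Prop :=
  forall (d : nat) (P : hpoly d),
    ~ (range (curve_point f) `<=` tropical_hypersurface P).

Definition curve_monomial d (I : expo n d) (x : R) : R :=
  (\sum_(i < n.+1) f i x *+ expo_at I i)%R.

(* F is a tropical combination, with real coefficients, of exactly j distinct
   f^I with |I| = d. *)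
Definition has_expression d (F : R -> \bar R) (j : nat) : Prop :=
  exists (K : {set expo n d}) (b : expo n d -> R),
    #|K| = j /\
    forall x, F x = \big[maxe/-oo]_(I in K) (b I + curve_monomial I x)%:E.

Definition is_shortest_length d (F : R -> \bar R) (j : nat) : Prop :=
  [/\ (1 <= j <= #|expo n d|)%N, has_expression d F j &
      forall k, (1 <= k <= #|expo n d|)%N -> has_expression d F k -> (j <= k)%N].

Definition complete d (F : R -> \bar R) : Prop :=
  is_shortest_length d F #|expo n d|.

Definition ddg d (J : finType) (A : {set J}) (F : J -> R -> \bar R) : nat :=
  #|[set j in A | ~~ `[< complete d (F j) >]]|.

Definition weil d (P : hpoly d) (x : R) : \bar R :=
  (curve_norm f x *+ d)%:E + coef_norm P *+ d - hpoly_comp P x.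

Definition proximity d (P : hpoly d) (r : R) : \bar R :=
  (2^-1)%:E * (weil P r + weil P (- r)%R).

Definition defect d (P : hpoly d) : \bar R :=
  limf_einf (fun r : R => proximity P r * ((d%:R * characteristic f r)^-1)%:E)
            (pinfty_nbhs R).

End Polynomials.

(* Main.v *)
(* Every defect lies in [0, 1]: a tropical entire function is convex, hence so
   is P(f), and midpoint convexity at 0 gives m_f(r, V_P) <= d T_f(r) + O(1),
   while nondegeneracy forces T_f(r) -> +oo. If P_j(f) is complete, all the
   coefficients of P_j at the pure powers x_i^d are finite, so that
   P_j(f) >= d ||f|| - O(1), the proximity function is bounded and the defect
   vanishes. The bounds on the sums are then a count of the indices j. *)
Require Import Defs.
From mathcomp Require Import all_boot all_order all_algebra.
From mathcomp Require Import all_classical all_reals all_analysis.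
From mathcomp Require Import ring lra.
Import Order.TTheory GRing.Theory Num.Theory.
Import numFieldNormedType.Exports.
Local Open Scope ring_scope.

(** * From local support lines to the absence of poles *)

Definition locally_supported {R : realType} (h : R -> R) (x : R) : Prop :=
  exists m : R, \forall y \near x, h x + m * (y - x) <= h y.

Lemma nbhs_ballR {R : realType} {x : R} {Q : R -> Prop} :
  (\forall y \near x, Q y) ->
  exists2 e : R, 0 < e & forall y, `|y - x| < e -> Q y.
Proof.
move=> /nbhs_ballP [e /= e0 He]; exists e => // y yxe.
by apply: He; rewrite /ball /= distrC.
Qed.

(* At an interior maximum c of h - (chord) + eps (y - a)(y - b), a local
   support line of h would force strict growth on one side of c. *)
Lemma le_chord {R : realType} {h : R -> R} {a b : R} :
  continuous h -> a < b ->
  (forall x, a < x < b -> locally_supported h x) ->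
  forall x, a <= x <= b -> (b - a) * h x <= (b - x) * h a + (x - a) * h b.
Proof.
move=> ch ab supp x /andP[ax xb].
have ba0 : 0 < b - a by rewrite subr_gt0.
(* It suffices to bound the excess over the chord by arbitrarily small multiples of (x - a)(b - x);
   the [+ 1] in the denominator below covers the case where this product vanishes. *)
suff H : forall eps : R, 0 < eps ->
    (b - a) * h x - ((b - x) * h a + (x - a) * h b) <= eps * ((x - a) * (b - x)).
  rewrite -subr_le0; apply/ler_addgt0Pl => e e0; rewrite addr0.
  have y0 : 0 <= (x - a) * (b - x) by rewrite mulr_ge0// subr_ge0.
  apply: (le_trans (H (e / ((x - a) * (b - x) + 1)) _)).
    by rewrite divr_gt0// ltr_wpDl.
  rewrite -mulrA ler_piMr ?(ltW e0)// mulrC ler_pdivrMr ?ltr_wpDl// mul1r lerDl.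
  exact: ler01.
move=> eps eps0.
pose g (y : R) : R := (b - a) * h y - ((b - y) * h a + (y - a) * h b)
  + eps * ((y - a) * (y - b)).
have cg : continuous g.
  move=> y; apply: cvgD; last first.
    by apply: cvgM; [exact: cvg_cst|apply: cvgM; apply: cvgB; exact: cvg_cst || exact: cvg_id].
  apply: cvgB; first by apply: cvgM; [exact: cvg_cst|exact: ch].
  by apply: cvgD; apply: cvgM; (apply: cvgB || apply: cvg_cst); (exact: cvg_cst || exact: cvg_id).
have [c cab gmax] := @EVT_max R g a b (ltW ab) (continuous_subspaceT cg).
have gx := gmax x; rewrite !in_itv /= in cab gx.
have {}gx := gx ltac:(by rewrite ax xb).
suff gc : g c <= 0 by move: (le_trans gx gc); rewrite /g; lra.
have [->|ca] := eqVneq c a; first by rewrite /g; nra.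
have [->|cb] := eqVneq c b; first by rewrite /g; nra.
have acb : a < c < b by move: cab; rewrite !lt_neqAle eq_sym ca cb.
have [m /nbhs_ballR [r r0 hm]] := supp c acb.
have /andP[ac cb'] := acb.
(* [k] is the slope at [c] of [g] once [h] is replaced by its support line; the rest is the square
   term, so maximality of [g c] gives [key]. *)
pose k := (b - a) * m + h a - h b + eps * (2 * c - a - b).
have key : forall y, `|y - c| < r -> a <= y <= b ->
    k * (y - c) + eps * (y - c) ^+ 2 <= 0.
  move=> y yr yab; have hy := hm y yr.
  have := gmax y; rewrite in_itv /= => /(_ yab).
  have : (b - a) * (h c + m * (y - c)) <= (b - a) * h y by rewrite ler_pM2l.
  by rewrite /g /k; lra.
(* One step size valid on both sides of [c]: adding [key] at [c + s] and at [c - s] cancels [k] and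
   leaves 2 eps s^2 <= 0. *)
pose s := Num.min (r / 2) (Num.min (c - a) (b - c)).
have s0 : 0 < s by rewrite !lt_min !subr_gt0 ac cb' andbT divr_gt0.
have [sr sa sb] : [/\ s < r, s <= c - a & s <= b - c].
  split; rewrite /s ?ge_min ?lexx ?orbT//.
  by rewrite gt_min; apply/orP; left; lra.
have s2 : 0 < eps * s ^+ 2 by rewrite mulr_gt0 ?exprn_gt0.
have k1 : k * s + eps * s ^+ 2 <= 0.
  have := key (c + s); rewrite addrAC subrr add0r gtr0_norm//.
  by apply=> //; apply/andP; split; lra.
have k2 : k * - s + eps * s ^+ 2 <= 0.
  have := key (c - s); rewrite addrAC subrr add0r normrN gtr0_norm// sqrrN.
  by apply=> //; apply/andP; split; lra.
lra.
Qed.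

(** Local affinity supports both [h] and [- h], so the chord inequality holds in both directions and
    [h] coincides with its chord. *)
Lemma affine_between {R : realType} {h : R -> R} {a b : R} :
  continuous h -> a < b ->
  (forall x, a < x < b -> exists m c, \forall y \near x, h y = m * y + c) ->
  exists m, forall x, a <= x <= b -> forall y, a <= y <= b ->
    h y = h x + m * (y - x).
Proof.
move=> ch ab aff; pose m := (h b - h a) / (b - a).
have ba0 : b - a != 0 by rewrite subr_eq0 gt_eqF.
suff H : forall x, a <= x <= b -> h x = h a + m * (x - a).
  by exists m => x xab y yab; rewrite (H x)// (H y)//; lra.
move=> x xab.
have nch : continuous (- h : R -> R) by move=> y; apply: cvgN; exact: ch.
have lo : (b - a) * h x <= (b - x) * h a + (x - a) * h b.
  apply: le_chord => // z /aff [p [c hp]]; exists p; near=> y.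
  rewrite (nbhs_singleton hp) (near hp y)//; lra.
have up : (b - a) * - h x <= (b - x) * - h a + (x - a) * - h b.
  apply: (@le_chord R (- h : R -> R) a b) => // z /aff [p [c hp]]; exists (- p); near=> y.
  rewrite !fctE (nbhs_singleton hp) (near hp y)//; lra.
apply: (mulfI ba0); rewrite /m mulrDr mulrA mulrCA mulfV// mulr1; lra.
Unshelve. all: by end_near. Qed.

(** The other break points within distance 1 form a finite, hence closed, set that misses [x]. *)
Lemma isolated_breaks {R : realType} {S : set R} (x : R) :
  (forall a b : R, finite_set (S `&` `[a, b])%classic) ->
  \forall y \near x, y != x -> ~ S y.
Proof.
move=> finS; set A := (S `&` `[x - 1, x + 1])%classic.
have clA : closed (A `\ x)%classic.
  apply: compact_closed; first exact: (@norm_hausdorff R R).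
  exact/finite_compact/finite_setD/finS.
have nA : \forall y \near x, ~ (A `\ x)%classic y.
  by apply: (open_nbhs_nbhs (conj (closed_openC clA) _)); move=> [_ /(_ erefl)].
have ball1 : \forall y \near x, `|x - y| < 1 by exact: (@near_ball R R x 1).
near=> y => yx Sy; apply: (near nA y) => //; split; last exact/eqP.
have : `|x - y| < 1 by near: y.
by rewrite ltr_norml => /andP[? ?]; split=> //=; rewrite in_itv /=; apply/andP; split; lra.
Unshelve. all: by end_near. Qed.

Lemma derive1_affine {R : realType} {h : R -> R} {x m : R} (a : R) :
  (\forall y \near x, h y = a + m * y) -> derive1 h x = m.
Proof.
move=> hx; have : is_derive x (1 : R) h m.
  apply: (near_eq_is_derive (f := fun y : R => a + m * y)).
    by near do apply/esym.
  apply: is_derive_eq; rewrite add0r.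
  by rewrite mul1r /GRing.scale /= mulr1.
by move=> ?; rewrite derive1E derive_val.
Unshelve. all: by end_near. Qed.

(** Close to [x] the function is affine on each side, and [omega] is the right slope minus the left
    slope. Without a pole this jump is nonnegative, so the right-hand line stays below [h] on the
    left as well. *)
Lemma entire_locally_supported {R : realType} {h : R -> R} (x : R) :
  tropical_entire h -> locally_supported h x.
Proof.
move=> [[ch [S [finS affS]]] nopole].
have [e e0 iso] := nbhs_ballR (isolated_breaks x finS).
have aff : forall y, `|y - x| < e -> y != x ->
    exists m c, \forall z \near y, h z = m * z + c.
  by move=> y ye yx; apply: affS; exact: iso.
(* Halving [e] keeps the closed intervals inside the ball whose only possible break is [x]. *)
have [m1 h1] : exists m, forall y, x <= y <= x + e / 2 -> forall z,
    x <= z <= x + e / 2 -> h z = h y + m * (z - y).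
  apply: affine_between => //; first lra.
  move=> y /andP[xy ye]; apply: aff; last by rewrite gt_eqF.
  by rewrite ger0_norm; lra.
have [m2 h2] : exists m, forall y, x - e / 2 <= y <= x -> forall z,
    x - e / 2 <= z <= x -> h z = h y + m * (z - y).
  apply: affine_between => //; first lra.
  move=> y /andP[xy ye]; apply: aff; last by rewrite lt_eqF.
  by rewrite ler0_norm; lra.
have om : omega h x = m1 - m2.
  apply: lim_near_cst; first exact: norm_hausdorff.
  near=> t.
  have t0 : 0 < t by [].
  have te : t < e / 2 by near: t; apply: nbhs_right_lt; lra.
  congr (_ - _).
    apply: (derive1_affine (h x - m1 * x)); near=> y.
    have : y \in `]x, (x + e / 2)[.
      by near: y; apply: near_in_itvoo; rewrite in_itv /=; apply/andP; split; lra.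
    rewrite in_itv /= => /andP[y1 y2].
    by rewrite (h1 x _ y); [lra|apply/andP; split; lra..].
  apply: (derive1_affine (h x - m2 * x)); near=> y.
  have : y \in `](x - e / 2), x[.
    by near: y; apply: near_in_itvoo; rewrite in_itv /=; apply/andP; split; lra.
  rewrite in_itv /= => /andP[y1 y2].
  by rewrite (h2 x _ y); [lra|apply/andP; split; lra..].
exists m1; near=> y.
have m12 : m2 <= m1 by have := nopole x; rewrite /is_tropical_pole om => /negP; rewrite -leNgt; lra.
have ye : `|y - x| < e / 2.
  rewrite distrC; near: y; apply: (@near_ball R R x (e / 2)); lra.
move: ye; rewrite ltr_norml => /andP[y1 y2].
have [xy|xy] := leP x y.
  by rewrite (h1 x _ y) ?lexx//; apply/andP; split; lra.
rewrite (h2 x _ y); [|by apply/andP; split; lra..].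
by rewrite lerD2l; nra.
Unshelve. all: end_near.
Qed.

(** * Convex functions on the line *)

Definition convex_on_line {R : realType} (h : R -> R) : Prop :=
  forall x y t, 0 <= t <= 1 -> h ((1 - t) * x + t * y) <= (1 - t) * h x + t * h y.

Lemma entire_convex {R : realType} {h : R -> R} :
  tropical_entire h -> convex_on_line h.
Proof.
move=> eh.
suff H : forall x y t, x < y -> 0 <= t <= 1 ->
    h ((1 - t) * x + t * y) <= (1 - t) * h x + t * h y.
  move=> x y t t01; have [xy|yx|->] := ltgtP x y.
  - exact: H.
  - have := H y x (1 - t) yx; have -> : 1 - (1 - t) = t by ring.
    by rewrite [(1 - t) * x + _]addrC [(1 - t) * h x + _]addrC; apply; lra.
  - by rewrite -!mulrDl subrK !mul1r.
move=> x y t xy t01.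
have := @le_chord R h x y eh.1.1 xy (fun z _ => entire_locally_supported z eh)
  ((1 - t) * x + t * y).
have -> : y - ((1 - t) * x + t * y) = (y - x) * (1 - t) by ring.
have -> : (1 - t) * x + t * y - x = (y - x) * t by ring.
rewrite -!mulrA -mulrDr ler_pM2l ?subr_gt0//; apply.
by apply/andP; split; nra.
Qed.

Lemma convex_mean_ge {R : realType} {h : R -> R} (r : R) :
  convex_on_line h -> h 0 <= 2^-1 * (h r + h (- r)).
Proof.
move=> ch; have := ch r (- r) 2^-1.
have -> : (1 - 2^-1) * r + 2^-1 * - r = 0 by field.
by move=> H; have {H} := H ltac:(lra); lra.
Qed.

Lemma convex_le_radial {R : realType} {h : R -> R} (x t : R) :
  convex_on_line h -> 0 <= t <= 1 -> h (t * x) <= (1 - t) * h 0 + t * h x.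
Proof. by move=> ch t01; have := ch 0 x t t01; rewrite mulr0 add0r. Qed.

(** Prolong the segment from [y] through [x] to distance |x - y| / t. The bound [C] at the far end
    gives h x <= h y + t (C - h y), and [t] is chosen so that the last term is at most [e]. *)
Lemma convex_bounded_cst {R : realType} {h : R -> R} {C : R} :
  convex_on_line h -> (forall x, h x <= C) -> forall x y, h x = h y.
Proof.
move=> ch hC; suff H : forall x y, h x <= h y.
  by move=> x y; apply/eqP; rewrite eq_le !H.
move=> x y; apply/ler_addgt0Pl => e e0.
have Cy : 0 <= C - h y by rewrite subr_ge0.
pose t := e / (C - h y + e).
have t0 : 0 < t by rewrite divr_gt0// ltr_wpDl.
have t1 : t <= 1 by rewrite ler_pdivrMr ?ltr_wpDl// mul1r lerDr.
have := ch y (y + (x - y) / t) t; rewrite (ltW t0) t1 => /(_ isT).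
have -> : (1 - t) * y + t * (y + (x - y) / t) = x by field; rewrite gt_eqF.
have te : t * (C - h y) <= e.
  by rewrite /t mulrAC ler_pdivrMr ?ltr_wpDl// ler_pM2l// lerDl ltW.
have := hC (y + (x - y) / t); set u := h _ => uC xu; nra.
Qed.

(** * Norm and characteristic of a curve *)

Lemma le_curve_norm {R : realType} {n : nat} (f : 'I_n.+1 -> R -> R) (i : 'I_n.+1) x :
  f i x <= curve_norm f x.
Proof. exact: (@le_bigmax _ _ _ _ (fun i => f i x)). Qed.

Lemma curve_norm_le {R : realType} {n : nat} (f : 'I_n.+1 -> R -> R) (c x : R) :
  (forall i, f i x <= c) -> curve_norm f x <= c.
Proof. by move=> fc; apply: bigmax_le. Qed.

Lemma convex_curve_norm {R : realType} {n : nat} {f : 'I_n.+1 -> R -> R} :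
  (forall i, convex_on_line (f i)) -> convex_on_line (curve_norm f).
Proof.
move=> cf x y t /[dup] t01 /andP[t0 t1]; apply: curve_norm_le => i.
apply: (le_trans (cf i x y t t01)); apply: lerD.
  by rewrite ler_wpM2l ?subr_ge0// le_curve_norm.
by rewrite ler_wpM2l// le_curve_norm.
Qed.

(* If the characteristic vanished identically, the norm would be affine, and
   the f_i, convex and bounded above by it, would be its translates. *)
Lemma characteristic_gt0 {R : realType} {n : nat} {f : 'I_n.+1 -> R -> R} :
  (forall i, convex_on_line (f i)) ->
  ~ (forall i j, exists c, forall x, f i x = f j x + c) ->
  exists2 r, 0 < r & 0 < characteristic f r.
Proof.
move=> cf ncst; apply: contrapT => noT; apply: ncst => i j.
have cg := convex_curve_norm cf; set g := curve_norm f in cg.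
have Tle r : 0 < r -> g r + g (- r) <= 2 * g 0.
  move=> r0; rewrite -subr_le0; have [//|T0] := leP; case: noT.
  by exists r => //; rewrite /characteristic -/g; lra.
have Tge r : 2 * g 0 <= g r + g (- r).
  by have := convex_mean_ge r cg; lra.
(* The convexity bounds for [g] at [t * s] and at its opposite add up to at most 2 g 0, while by
   [Tge] the values add up to at least that; hence both are equalities. *)
have scale t s : 0 <= t <= 1 -> 0 < s -> g (t * s) = g 0 + t * (g s - g 0).
  move=> t01 s0; have := convex_le_radial s t cg t01.
  have := convex_le_radial (- s) t cg t01; rewrite mulrN.
  have := Tge (t * s); have := Tge s; have := Tle s s0.
  have /andP[t0 t1] := t01; move=> h1 h2 h3 h4 h5; nra.
have gpos x : 0 <= x -> g x = g 0 + x * (g 1 - g 0).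
  move=> x0; have [x1|x1] := leP x 1.
    by have := scale x 1; rewrite mulr1 => -> //; rewrite x0 x1.
  have x0' : 0 < x by lra.
  have := scale x^-1 x; rewrite mulVf ?gt_eqF// => -> //.
    by field; rewrite gt_eqF.
  by rewrite invr_ge0 x0 invf_le1// ltW.
have gE x : g x = g 0 + x * (g 1 - g 0).
  have [x0|x0] := leP 0 x; first exact: gpos.
  have nx : 0 < - x by lra.
  have := Tle _ nx; have := Tge (- x).
  by rewrite opprK (gpos (- x) (ltW nx)); lra.
set k := g 1 - g 0 in gE.
(* Removing the slope [k] of the norm leaves each component convex and bounded above by [g 0], hence
   constant. *)
have bnd l x y : f l x - x * k = f l y - y * k.
  apply: (@convex_bounded_cst R (fun x => f l x - x * k) (g 0)).
    by move=> u v t /(cf l u v); lra.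
  by move=> u; have := le_curve_norm f l u; rewrite -/g gE; lra.
exists (f i 0 - f j 0) => x.
by have := bnd i x 0; have := bnd j x 0; lra.
Qed.

(** Convexity of the norm along both rays gives T(s) / s <= T(r) / r for r >= s, so a single [s]
    with positive characteristic forces at least linear growth. *)
Lemma characteristic_cvgy {R : realType} {n : nat} {f : 'I_n.+1 -> R -> R} :
  (forall i, convex_on_line (f i)) ->
  ~ (forall i j, exists c, forall x, f i x = f j x + c) ->
  (characteristic f r @[r --> +oo] --> +oo)%classic.
Proof.
move=> cf ncst; have [s s0 Ts] := characteristic_gt0 cf ncst.
have cg := convex_curve_norm cf.
apply/cvgryPge => A; near=> r.
have r0 : 0 < r by near: r; apply: nbhs_pinfty_gt; exact: num_real.
have sr : s <= r by near: r; apply: nbhs_pinfty_ge; exact: num_real.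
have Ar : A * s / characteristic f s <= r by near: r; apply: nbhs_pinfty_ge; exact: num_real.
have t01 : 0 <= s / r <= 1.
  by rewrite ler_pdivrMr// mul1r sr andbT divr_ge0 ?(ltW r0) ?(ltW s0).
have sE : s / r * r = s by rewrite divfK// gt_eqF.
have Tsr : characteristic f s <= s / r * characteristic f r.
  have := convex_le_radial r _ cg t01; have := convex_le_radial (- r) _ cg t01.
  by rewrite mulrN sE /characteristic; lra.
rewrite -(ler_pM2l s0) mulrC.
rewrite ler_pdivrMr// in Ar; apply: (le_trans Ar).
by move: Tsr; rewrite mulrAC ler_pdivlMr// mulrC.
Unshelve. all: by end_near. Qed.

(** * Exponents, monomials and pure powers *)

Lemma sum_expo_at {n d : nat} (I : expo n d) : (\sum_i expo_at I i)%N = d.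
Proof. by have /eqP := valP I; rewrite big_tuple. Qed.

Lemma expo_at_inj {n d : nat} {I J : expo n d} :
  (forall i, expo_at I i = expo_at J i) -> I = J.
Proof. by move=> IJ; apply/val_inj/eq_from_tnth => i; apply/val_inj/IJ. Qed.

Lemma expo_with {n d : nat} (a : 'I_n.+1 -> nat) :
  (\sum_i a i)%N = d -> exists I : expo n d, forall i, expo_at I i = a i.
Proof.
(* [inord] alters no entry, since each [a i] is at most the total [d]. *)
move=> ad; pose t := [tuple inord (a i) : 'I_d.+1 | i < n.+1].
have tE i : nat_of_ord (tnth t i) = a i.
  by rewrite tnth_mktuple inordK// ltnS -ad (bigD1 i)//= leq_addr.
have td : (\sum_(i <- t) nat_of_ord i == d)%N.
  by rewrite big_tuple (eq_bigr a) ?ad// => i _; exact: tE.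
by exists (exist _ t td).
Qed.

Lemma pure_expo_exists (n d : nat) (i : 'I_n.+1) :
  exists I : expo n d, forall j, expo_at I j = if j == i then d else 0%N.
Proof.
by apply: expo_with; rewrite -big_mkcond/= big_pred1_eq.
Qed.

Definition pure_expo (n d : nat) (i : 'I_n.+1) : expo n d :=
  projT1 (cid (pure_expo_exists n d i)).

Lemma expo_at_pure (n d : nat) (i j : 'I_n.+1) :
  expo_at (pure_expo n d i) j = if j == i then d else 0%N.
Proof. by rewrite /pure_expo; case: cid. Qed.

Lemma curve_monomial_pure {R : realType} {n : nat} (f : 'I_n.+1 -> R -> R) d i x :
  curve_monomial f (pure_expo n d i) x = f i x *+ d.
Proof.
rewrite /curve_monomial (bigD1 i)//= expo_at_pure eqxx big1 ?addr0// => j ji.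
by rewrite expo_at_pure (negbTE ji) mulr0n.
Qed.

Lemma curve_monomial_le {R : realType} {n : nat} (f : 'I_n.+1 -> R -> R) d
    (I : expo n d) x : curve_monomial f I x <= curve_norm f x *+ d.
Proof.
rewrite -[X in _ *+ X](sum_expo_at I) -sumrMnr; apply: ler_sum => i _.
by rewrite lerMn2r le_curve_norm orbT.
Qed.

Lemma curve_monomial_mean_ge {R : realType} {n : nat} {f : 'I_n.+1 -> R -> R} {d}
    (I : expo n d) r : (forall i, convex_on_line (f i)) ->
  curve_monomial f I 0 <= 2^-1 * (curve_monomial f I r + curve_monomial f I (- r)).
Proof.
move=> cf; rewrite /curve_monomial -big_split mulr_sumr /=.
apply: ler_sum => i _; rewrite -mulrnDl mulrnAr lerMn2r orbC.
by rewrite (convex_mean_ge r (cf i)).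
Qed.

(** * Bounds for P(f) and for the proximity function *)

Section HomogeneousPolynomial.
Context {R : realType} {n d : nat} (f : 'I_n.+1 -> R -> R) (P : hpoly R n d).
Local Open Scope ereal_scope.

Lemma hpoly_term_curve x I :
  hpoly_term P (curve_point f x) I = P I + (curve_monomial f I x)%:E.
Proof.
rewrite /hpoly_term /curve_monomial -sumEFin; congr (_ + _).
by apply: eq_bigr => i _; rewrite EFin_natmul.
Qed.

Lemma hpoly_comp_ge x I :
  P I + (curve_monomial f I x)%:E <= hpoly_comp f P x.
Proof. by rewrite -hpoly_term_curve; exact: le_bigmax. Qed.

Lemma hpoly_comp_le x c : (forall I, P I + (curve_monomial f I x)%:E <= c) ->
  hpoly_comp f P x <= c.
Proof.
by move=> H; apply: bigmax_le => [|I _]; rewrite ?leNye ?hpoly_term_curve.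
Qed.

Lemma hpoly_comp_fin x : hpoly_comp f P x \is a fin_num.
Proof.
rewrite fin_numE -ltNye -ltey; apply/andP; split.
  have [I PI] := coef_nontrivial P; apply: lt_le_trans (hpoly_comp_ge x I).
  by case: (P I) PI => // r _; rewrite ltNyr.
apply: bigmax_lt => // I _; rewrite hpoly_term_curve.
by case: (P I) (coef_lty P I) => // r _; rewrite ltry.
Qed.

Lemma coef_norm_fin : coef_norm P \is a fin_num.
Proof.
rewrite fin_numE -ltNye -ltey; apply/andP; split.
  by have [I PI] := coef_nontrivial P; apply: lt_le_trans PI _; exact: (@le_bigmax _ _ _ _ (coef P)).
by apply: bigmax_lt => // I _; exact: coef_lty.
Qed.

Lemma hpoly_comp_norm_le x :
  hpoly_comp f P x <= coef_norm P + (curve_norm f x *+ d)%:E.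
Proof.
apply: hpoly_comp_le => I; apply: leeD; first exact: le_bigmax.
by rewrite lee_fin curve_monomial_le.
Qed.

(** Each term of P(f) with finite coefficient satisfies the midpoint inequality and is dominated by
    P(f) at [r] and [- r]; terms with coefficient -oo are harmless. *)
Lemma hpoly_comp_mean_ge r : (forall i, convex_on_line (f i)) ->
  (fine (hpoly_comp f P 0) <=
   2^-1 * (fine (hpoly_comp f P r) + fine (hpoly_comp f P (- r))))%R.
Proof.
move=> cf; rewrite -lee_fin fineK ?hpoly_comp_fin//; apply: hpoly_comp_le => I.
have := hpoly_comp_ge r I; have := hpoly_comp_ge (- r) I.
have := coef_lty P I; case: (P I) => [p _| |]//; last by move=> *; rewrite addNye leNye.
rewrite -(fineK (hpoly_comp_fin r)) -(fineK (hpoly_comp_fin (- r))) /= !lee_fin.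
by have := curve_monomial_mean_ge I r cf; lra.
Qed.

(** The pure term at [i] bounds d f_i by P(f) minus its finite coefficient; the sum of the absolute
    values of these coefficients serves all [i] at once. *)
Lemma hpoly_comp_norm_ge : (0 < d)%N -> (forall i, -oo < P (pure_expo n d i)) ->
  exists C, forall x, (curve_norm f x *+ d - C <= fine (hpoly_comp f P x))%R.
Proof.
move=> d0 Ppure; pose p i := fine (P (pure_expo n d i)).
have pE i : P (pure_expo n d i) = (p i)%:E.
  by rewrite fineK// fin_numE -ltNye -ltey Ppure coef_lty.
have d0' : (0 < d%:R :> R)%R by rewrite ltr0n.
exists (\sum_i `|p i|)%R => x; rewrite lerBlDr -mulr_natr -ler_pdivlMr//.
apply: curve_norm_le => i; rewrite ler_pdivlMr// mulr_natr.
have := hpoly_comp_ge x (pure_expo n d i).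
rewrite pE -(fineK (hpoly_comp_fin x)) curve_monomial_pure -EFinD lee_fin.
have : (`|p i| <= \sum_i `|p i|)%R by rewrite (bigD1 i)//= lerDl sumr_ge0.
by have := ler_norm (- p i)%R; rewrite normrN; lra.
Qed.

Lemma proximityE r : proximity f P r =
  (2^-1 * ((curve_norm f r *+ d + fine (coef_norm P) *+ d - fine (hpoly_comp f P r))
  + (curve_norm f (- r) *+ d + fine (coef_norm P) *+ d
     - fine (hpoly_comp f P (- r)))))%:E.
Proof.
rewrite /proximity /weil -(fineK coef_norm_fin) -(fineK (hpoly_comp_fin r)).
by rewrite -(fineK (hpoly_comp_fin (- r))) -EFin_natmul.
Qed.

Lemma proximity_lower_bound :
  exists C, forall r, (C <= fine (proximity f P r))%R.
Proof.
(* [weil] adds the coefficient norm [d] times, whereas P(f) exceeds d ||f|| by at most one copy of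
   it; the constant is the difference. *)
exists (fine (coef_norm P) *+ d - fine (coef_norm P))%R => r; rewrite proximityE /=.
have H x : (fine (hpoly_comp f P x) <= fine (coef_norm P) + curve_norm f x *+ d)%R.
  rewrite -lee_fin EFinD !fineK ?hpoly_comp_fin ?coef_norm_fin//.
  exact: hpoly_comp_norm_le.
by have := H r; have := H (- r)%R; lra.
Qed.

(** This stands in for the first main theorem: the mean of P(f) over [r] and [- r] is at least its
    value at 0, and [C] is the Weil function at 0. *)
Lemma proximity_upper_bound : (forall i, convex_on_line (f i)) ->
  exists C, forall r,
    (fine (proximity f P r) <= d%:R * characteristic f r + C)%R.
Proof.
move=> cf.
exists (curve_norm f 0 *+ d + fine (coef_norm P) *+ d - fine (hpoly_comp f P 0))%R.
move=> r; rewrite proximityE /characteristic /=.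
have := hpoly_comp_mean_ge r cf.
rewrite -[(curve_norm f r *+ d)%R]mulr_natl -[(curve_norm f (- r) *+ d)%R]mulr_natl.
by rewrite -[(curve_norm f 0 *+ d)%R]mulr_natl; lra.
Qed.

Lemma proximity_pure_bounded : (0 < d)%N -> (forall i, -oo < P (pure_expo n d i)) ->
  exists C, forall r, (fine (proximity f P r) <= C)%R.
Proof.
move=> d0 /(hpoly_comp_norm_ge d0) [C HC].
exists (C + fine (coef_norm P) *+ d)%R => r; rewrite proximityE /=.
by have := HC r; have := HC (- r)%R; lra.
Qed.

End HomogeneousPolynomial.

(** * Defects as lower limits *)

Lemma limf_einf_le {T : choiceType} {X : filteredType T} {R : realType}
    (F : set (set X)) (FF : ProperFilter F) (g : X -> \bar R) (c : \bar R) :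
  F [set x | (g x <= c)%E]%classic -> (limf_einf g F <= c)%E.
Proof.
move=> gc; rewrite limf_einfE; apply: ge_ereal_sup => _ [V FV <-].
have [x [Vx gx]] := filter_ex (filterI FV gc).
by apply: ge_ereal_inf; exists (g x) => //; exists x.
Qed.

Lemma limf_einf_ge {T : choiceType} {X : filteredType T} {R : realType}
    (F : set (set X)) (g : X -> \bar R) (c : \bar R) :
  F [set x | (c <= g x)%E]%classic -> (c <= limf_einf g F)%E.
Proof.
move=> gc; rewrite limf_einfE.
apply: le_ereal_sup_tmp; exists (ereal_inf (g @` [set x | (c <= g x)%E])%classic).
  by exists [set x | (c <= g x)%E]%classic.
by apply: le_ereal_inf_tmp => _ [x cx <-].
Qed.

Lemma proximity_fin {R : realType} {n d : nat} (f : 'I_n.+1 -> R -> R)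
    (P : hpoly R n d) r : proximity f P r \is a fin_num.
Proof. by rewrite proximityE. Qed.

(** Absorbs bounded errors: after division by d T_f(r), the constant [C] contributes at most [e]. *)
Lemma near_inv_characteristic {R : realType} {n : nat} {f : 'I_n.+1 -> R -> R}
    (C e : R) (d : nat) : (0 < d)%N -> 0 < e ->
  (characteristic f r @[r --> +oo] --> +oo)%classic ->
  \forall r \near +oo, 0 < d%:R * characteristic f r /\
                       C <= e * (d%:R * characteristic f r).
Proof.
move=> d0 e0 /cvgryPge Ty.
have d0' : 0 < d%:R :> R by rewrite ltr0n.
near=> r.
have T1 : 1 <= characteristic f r by near: r; exact: Ty.
have TC : C / (e * d%:R) <= characteristic f r by near: r; exact: Ty.
split; first by rewrite mulr_gt0//; lra.
by rewrite mulrA -ler_pdivrMl ?mulr_gt0// mulrC.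
Unshelve. all: by end_near. Qed.

(** Meant for c = 1 with an arbitrary polynomial and for c = 0 when the proximity function is
    bounded. *)
Lemma defect_le {R : realType} {n d : nat} {f : 'I_n.+1 -> R -> R}
    {P : hpoly R n d} (c C : R) : (0 < d)%N ->
  (characteristic f r @[r --> +oo] --> +oo)%classic ->
  (forall r, fine (proximity f P r) <= c * (d%:R * characteristic f r) + C) ->
  (defect f P <= c%:E)%E.
Proof.
move=> d0 Ty bnd; apply/lee_addgt0Pr => e e0; apply: limf_einf_le.
apply: filterS (near_inv_characteristic C e d d0 e0 Ty) => r [T0 TC] /=.
rewrite -(fineK (proximity_fin f P r)) -EFinM -EFinD lee_fin ler_pdivrMr//.
by apply: (le_trans (bnd r)); lra.
Qed.

Lemma defect_ge0 {R : realType} {n d : nat} {f : 'I_n.+1 -> R -> R}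
    {P : hpoly R n d} : (0 < d)%N ->
  (characteristic f r @[r --> +oo] --> +oo)%classic -> (0 <= defect f P)%E.
Proof.
move=> d0 Ty; have [C HC] := proximity_lower_bound f P.
apply/lee_addgt0Pr => e e0; rewrite -leeBlDr// sub0e; apply: limf_einf_ge.
apply: filterS (near_inv_characteristic (- C) e d d0 e0 Ty) => r [T0 TC] /=.
rewrite -(fineK (proximity_fin f P r)) -EFinM lee_fin ler_pdivlMr//.
by have := HC r; lra.
Qed.

(** * Nondegeneracy, completeness and pure powers *)

Lemma nondegenerate_not_constant {R : realType} {n : nat} {f : 'I_n.+1 -> R -> R} :
  (0 < n)%N -> algebraically_nondegenerate f ->
  ~ (forall i j, exists c, forall x, f i x = f j x + c).
Proof.
move=> n0 nd cst; have [c fc] := cst ord0 ord_max.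
pose e0 : expo n 1 := pure_expo n 1 ord0; pose e1 : expo n 1 := pure_expo n 1 ord_max.
have e01 : e0 != e1.
  apply/eqP => /(congr1 (fun I => expo_at I ord0)).
  by rewrite !expo_at_pure eqxx; case: eqVneq => // /(congr1 val)/= n0'; rewrite -n0' in n0.
(* Coefficients of the linear polynomial max(x_0, c + x_n): its two terms agree along the curve, so
   the whole image lies in its hypersurface. *)
pose a (I : expo n 1) : \bar R := if I == e0 then 0%E else if I == e1 then c%:E else -oo%E.
have aty I : (a I < +oo)%E.
  by rewrite /a; case: eqP => // _; case: eqP => // _; rewrite ltry.
have ant : exists I, (-oo < a I)%E by exists e0; rewrite /a eqxx ltNyr.
pose P := HPoly aty ant.
apply: (nd 1%N P) => _ [x _ <-]; split=> [i|]; first exact: ltry.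
split; first by exists ord0; exact: ltNyr.
have t0 : hpoly_term P (curve_point f x) e0 = (f ord0 x)%:E.
  by rewrite hpoly_term_curve /= /a eqxx add0e curve_monomial_pure.
have t1 : hpoly_term P (curve_point f x) e1 = (f ord0 x)%:E.
  rewrite hpoly_term_curve /= /a eq_sym (negbTE e01) eqxx curve_monomial_pure.
  by rewrite fc addrC.
suff ev : hpoly_eval P (curve_point f x) = (f ord0 x)%:E.
  by exists e0, e1; rewrite t0 t1 ev.
apply/eqP; rewrite eq_le -{2}t0 le_bigmax andbT.
apply: bigmax_le => [|I _]; first exact: leNye.
have [->|I0] := eqVneq I e0; first by rewrite t0.
have [->|I1] := eqVneq I e1; first by rewrite t1.
by rewrite hpoly_term_curve /= /a (negbTE I0) (negbTE I1) addNye leNye.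
Qed.

Lemma enatmul_max {R : realType} (m : nat) (x y : \bar R) :
  ((maxe x y) *+ m = maxe (x *+ m) (y *+ m))%E.
Proof.
have mono (u v : \bar R) : (u <= v -> u *+ m <= v *+ m)%E.
  by move=> uv; elim: m => // k IH; rewrite !muleS leeD.
have [xy|yx] := leP x y; first by apply/esym/max_idPr/mono.
by apply/esym/max_idPl/mono/ltW.
Qed.

(* The tropical Frobenius identity: P^m only involves the m-th powers of the
   monomials of P. *)
Lemma hpoly_power_expression {R : realType} {n e : nat} (f : 'I_n.+1 -> R -> R)
    (P : hpoly R n e) (m : nat) : (0 < m)%N ->
  exists (g : expo n e -> expo n (m * e)) (b : expo n (m * e) -> R),
    (forall I i, expo_at (g I) i = m * expo_at I i)%N /\
    forall x, (hpoly_comp f P x *+ m)%E =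
      \big[maxe/-oo%E]_(J in [set g I | I in [pred I | -oo < P I]%E])
        (b J + curve_monomial f J x)%:E.
Proof.
move=> m0.
have /choice [g gE] : forall I : expo n e, exists J : expo n (m * e),
    forall i, (expo_at J i = m * expo_at I i)%N.
  by move=> I; apply: expo_with; rewrite -big_distrr /= sum_expo_at.
have ginj : injective g.
  move=> I J gIJ; apply: expo_at_inj => i; apply/eqP.
  by rewrite -(eqn_pmul2l m0) -!gE gIJ.
(* Injectivity of [g] makes the coefficient well defined on its image; elsewhere the value 0 is
   arbitrary. *)
have /choice [b bE] : forall J, exists c : R, forall I, g I = J -> fine (P I) *+ m = c.
  move=> J; have [[I gI]|nI] := pselect (exists I, g I = J).
    by exists (fine (P I) *+ m) => I' gI'; congr (fine (P _) *+ m); apply: ginj; rewrite gI.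
  by exists 0 => I gI; case: nI; exists I.
exists g, b; split=> // x; rewrite big_imset/=; last by move=> ? ? _ _; exact: ginj.
rewrite /hpoly_comp /hpoly_eval [RHS]big_mkcond/=.
(* Positivity of [m] matters for the neutral element: -oo *+ m is -oo, but -oo *+ 0 is 0. *)
rewrite (big_morph (fun y : \bar R => y *+ m)%E (enatmul_max m) (id1 := -oo%E)); last first.
  by case: m m0 {g gE ginj b bE} => // m _; rewrite enatmul_ninfty.
apply: eq_bigr => I _; rewrite hpoly_term_curve inE.
have := coef_lty P I; have := bE _ I erefl; case: (P I) => [p| |] //= pb _; last first.
  by rewrite addNye; case: m m0 {g gE ginj b bE pb} => // m _; rewrite enatmul_ninfty.
rewrite ltNyr -pb -EFin_natmul mulrnDl; congr (_ + _)%:E.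
rewrite /curve_monomial -sumrMnl; apply: eq_bigr => i _.
by rewrite gE mulnC mulrnA.
Qed.

(** Were the coefficient at x_i^e equal to -oo, the Frobenius expression of P^m would omit x_i^(m e)
    and so use fewer than all monomials, against completeness. *)
Lemma complete_pure_coef {R : realType} {n e d : nat} {f : 'I_n.+1 -> R -> R}
    {P : hpoly R n e} (m : nat) : (0 < m)%N -> d = (m * e)%N ->
  complete f d (fun x => hpoly_comp f P x *+ m)%E ->
  forall i, (-oo < P (pure_expo n e i))%E.
Proof.
move=> m0 -> [_ _ minlen] i; rewrite ltNye; apply/negP => /eqP PNy.
have [g [b [gE FE]]] := hpoly_power_expression f P m m0.
set K := [set g I | I in [pred I | -oo < P I]%E]%SET in FE.
have K0 : (0 < #|K|)%N.
  have [I PI] := coef_nontrivial P; rewrite card_gt0; apply/set0Pn.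
  by exists (g I); apply/imsetP; exists I.
have KT : (#|K| < #|expo n (m * e)|)%N.
  rewrite -cardsT; apply: proper_card; rewrite properT; apply/eqP => KT.
  have : pure_expo n (m * e) i \in K by rewrite KT.
  move=> /imsetP[I]; rewrite inE => PI gI; move: PI.
  (* Cancelling [m] shows that only the pure exponent of degree [e] is sent to the pure exponent of
     degree [m * e]. *)
  suff -> : I = pure_expo n e i by rewrite PNy ltxx.
  apply: expo_at_inj => j; apply/eqP.
  rewrite -(eqn_pmul2l m0) -gE -gI !expo_at_pure.
  by case: ifP => // _; rewrite muln0.
have := minlen #|K|; rewrite K0 (ltnW KT) => /(_ isT).
by rewrite leqNgt KT => H; have := H (ex_intro _ K (ex_intro _ b (conj erefl FE))).
Qed.

(** * Counting the defects *)

Theorem theorem4p10 (R : realType) (q n : nat) (f : 'I_n.+1 -> R -> R)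
    (deg : 'I_q -> nat) (P : forall j : 'I_q, hpoly R n (deg j)) :
  (0 < q)%N -> (0 < n)%N -> (n <= q)%N ->
  reduced_representation f ->
  algebraically_nondegenerate f ->
  (forall j, (0 < deg j)%N) ->
  let d := \big[lcmn/1%N]_(j < q) deg j in
  let M := ('C(n + d, d)).-1 in
  (* j : 'I_q is the index j + 1 of the usual numbering 1, ..., q; for those
     from M + 2 on, P_j o f is raised to the tropical power d / deg j. *)
  let lambda := ddg f d [set j : 'I_q | (M.+2 <= j.+1)%N]%SET
                  (fun j x => (hpoly_comp f (P j) x *+ (d %/ deg j)%N)%E) in
  limf_esup (fun r : R => (ln (characteristic f r) / r)%:E) (pinfty_nbhs R)
    = 0%E ->
  [/\ (\sum_(j < q) defect f (P j) <= (M + 1 + lambda)%:R%:E)%E,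
      (\sum_(j < q | (M.+2 <= j.+1)%N) defect f (P j) <= lambda%:R%:E)%E &
      lambda = 0%N ->
      forall j : 'I_q, (M.+2 <= j.+1)%N -> defect f (P j) = 0%E].
Proof.
move=> _ n0 _ [entf _] nd deg0 d M lambda _.
have cf i := entire_convex (entf i).
have Ty := characteristic_cvgy cf (nondegenerate_not_constant n0 nd).
have def_ge0 j : (0 <= defect f (P j))%E by exact: defect_ge0.
have def_le1 j : (defect f (P j) <= 1%N%:R%:E)%E.
  have [C HC] := proximity_upper_bound f (P j) cf.
  by apply: (defect_le 1 C) => // r; rewrite mul1r.
have degd j : d = (d %/ deg j * deg j)%N.
  by apply/esym/divnK; rewrite /d (bigD1 j)//= dvdn_lcml.
have d0 : (0 < d)%N.
  by rewrite /d; elim/big_ind: _ => // x y x0 y0; rewrite lcmn_gt0 x0 y0.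
pose F j x := (hpoly_comp f (P j) x *+ (d %/ deg j)%N)%E.
have def0 j : complete f d (F j) -> defect f (P j) = 0%E.
  have m0 : (0 < d %/ deg j)%N by move: d0; rewrite {1}(degd j) muln_gt0 => /andP[].
  move=> /(complete_pure_coef _ m0 (degd j)).
  move=> /(proximity_pure_bounded f (P j) (deg0 j)) [C HC].
  apply/eqP; rewrite eq_le def_ge0 andbT.
  by apply: (defect_le 0 C) => // r; rewrite mul0r add0r.
pose A := [set j : 'I_q | (M.+2 <= j.+1)%N]%SET.
(* The indicator of non-completeness dominates each defect; summed over the tail it counts
   [lambda]. *)
have def_le j : (defect f (P j) <= (~~ `[< complete f d (F j) >])%:R%:E)%E.
  by case: asboolP => [/def0 ->|_] //=; exact: def_le1.
have tail : (\sum_(j < q | (M.+2 <= j.+1)%N) defect f (P j) <= lambda%:R%:E)%E.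
  apply: (le_trans (lee_sum _ (fun j _ => def_le j))).
  rewrite sumEFin lee_fin -natr_sum ler_nat -big_mkcondr/= sum1_card.
  by rewrite /lambda /ddg; apply/subset_leq_card/fintype.subsetP => j; rewrite !inE.
split=> //.
  rewrite (bigID (fun j : 'I_q => M.+2 <= j.+1)%N)/= natrD EFinD addeC.
  apply: leeD => //.
  apply: (le_trans (lee_sum _ (fun j _ => def_le1 j))).
  rewrite sumEFin lee_fin -natr_sum ler_nat sum1_card.
  (* Indices outside the tail have value at most [M], so they embed in 0, ..., M, whether or not [q]
     reaches M + 1. *)
  rewrite cardE -(size_map val) -[leqRHS](size_iota 0 (M + 1)).
  apply: uniq_leq_size => [|k /mapP[j]].
    by rewrite map_inj_uniq ?enum_uniq//; exact: val_inj.
  by rewrite mem_enum mem_iota unfold_in /= -ltnNge ltnS addn1 => jM ->.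
move=> l0 j Mj; apply: def0; apply: contrapT => nc.
have : j \in [set j in A | ~~ `[< complete f d (F j) >]]%SET.
  by rewrite !inE Mj; apply/asboolPn.
by rewrite (cards0_eq l0) inE.
Qed.
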